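(* The set $\operatorname{Sch}^{\mathrm{fin}}(\mathbb Z)$ is an open dense subset of $\operatorname{Sch}(\mathbb Z)$.
   Context: For a set $X$, $\beta(X)$ denotes the set of all ultrafilters on $X$, with the topology generated by the base $\{\langle A\rangle : A\subseteq X\}$, where $\langle A\rangle=\{u\in\beta(X): A\in u\}$ (the Stone–Čech compactification of the discrete space $X$). An ultrafilter is free if the intersection of all its members is empty. An ultrafilter $u$ on the group $(\mathbb Z,+)$ is called Schur if for each $U\in u$ there exist $a,b\in U$ with $a+b\in U$; it is called infinitary Schur if for each $U\in u$ there exist $a\in U$ and an infinite subset $B\subseteq U$ with $a+B\subseteq U$. $\operatorname{Sch}(\mathbb Z)$ is the subspace of $\beta(\mathbb Z)$ consisting of all free Schur ultrafilters, and $\operatorname{Sch}^{\mathrm{fin}}(\mathbb Z)$ is the subspace of $\beta(\mathbb Z)$ consisting of all free Schur ultrafilters on $\mathbb Z$ that are not infinitary Schur. *)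

(* Defs.v *)
From HB Require Import structures.
From mathcomp Require Import all_boot all_order all_algebra.
From mathcomp Require Import boolp classical_sets functions cardinality.
From mathcomp Require Import filter topology.

Set Implicit Arguments.
Unset Strict Implicit.
Unset Printing Implicit Defensive.

Import GRing.Theory.
Local Open Scope classical_set_scope.
Local Open Scope ring_scope.

Record beta (X : Type) := Beta {
  beta_sets :> set_system X;
  beta_ultra : UltraFilter beta_sets
}.
#[global] Existing Instance beta_ultra.

Definition beta_base (X : Type) (A : set X) : set (beta X) :=
  [set u | beta_sets u A].

Section BetaTopology.
Variable X : Type.

HB.instance Definition _ := gen_eqMixin (beta X).
HB.instance Definition _ := gen_choiceMixin (beta X).

Lemma beta_base_cover : \bigcup_(A in setT) @beta_base X A = setT.
Proof.
by rewrite -subTset => u _; exists setT => //; exact: (@filterT _ u _).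
Qed.

Lemma beta_base_join (A B : set X) (u : beta X) :
  [set: set X] A -> [set: set X] B -> beta_base A u -> beta_base B u ->
  exists C, [/\ [set: set X] C, beta_base C u
    & beta_base C `<=` beta_base A `&` beta_base B].
Proof.
move=> _ _ uA uB; exists (A `&` B); split=> //; first exact: (@filterI _ u _).
move=> v vAB; split; apply: (@filterS _ v _ _ _ _ vAB); last exact: subIsetr.
exact: subIsetl.
Qed.

HB.instance Definition _ := @isBaseTopological.Build (beta X) (set X)
  setT (@beta_base X) beta_base_cover beta_base_join.

End BetaTopology.

Definition free_ultrafilter (X : Type) (u : beta X) : Prop :=
  \bigcap_(A in beta_sets u) A = set0.

(* The witnesses a and b need not be distinct. *)
Definition Schur (G : zmodType) (u : beta G) : Prop :=
  forall U : set G, beta_sets u U ->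
    exists a b : G, [/\ U a, U b & U (a + b)].

Definition infinitary_Schur (G : zmodType) (u : beta G) : Prop :=
  forall U : set G, beta_sets u U ->
    exists (a : G) (B : set G),
      [/\ U a, infinite_set B, B `<=` U & [set a + b | b in B] `<=` U].

Definition Sch (G : zmodType) : set (beta G) :=
  [set u | free_ultrafilter u /\ Schur u].

Definition Sch_fin (G : zmodType) : set (beta G) :=
  [set u | [/\ free_ultrafilter u, Schur u & ~ infinitary_Schur u]].

Arguments Sch G : clear implicits.
Arguments Sch_fin G : clear implicits.

(* Main.v *)
(* Openness is immediate: a set U witnessing that u is not infinitary Schur
   witnesses the same for every ultrafilter containing U.
   For density, call X colorable when some finite coloring has no monochromatic
   triple a, b, a + b in X.  A Schur ultrafilter contains no colorable set, and
   a non-colorable set X not containing 0 belongs to a free Schur ultrafilter,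
   since the colorable sets form an ideal containing the nonzero singletons.
   Given A in a free Schur ultrafilter, which also contains all sets N Z minus
   0, compactness yields finite subsets F_r of A that are not r-colorable, with
   the elements of F_r divisible by a number much larger than the elements of
   the previous blocks.  Their union S is not colorable, but for each a in S
   only finitely many b in S satisfy a + b in S. *)
Require Import Defs.
From HB Require Import structures.
From mathcomp Require Import all_boot all_order all_algebra zify.
From mathcomp Require Import boolp classical_sets functions cardinality.
From mathcomp Require Import filter topology.

Local Open Scope classical_set_scope.

Set Implicit Arguments.
Unset Strict Implicit.
Unset Printing Implicit Defensive.

Import GRing.Theory Num.Theory.

Section SchurColorings.
Variable G : zmodType.
Local Open Scope ring_scope.

Definition Schur_colorable (T : finType) (X : set G) : Prop :=
  exists c : G -> T, forall a b : G,
    X a -> X b -> X (a + b) -> c a = c b -> c b = c (a + b) -> False.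

Lemma Schur_colorable_sub (T : finType) (X Y : set G) :
  X `<=` Y -> Schur_colorable T Y -> Schur_colorable T X.
Proof. by move=> XY [c cP]; exists c => a b /XY Ya /XY Yb /XY; exact: cP. Qed.

Lemma Schur_colorable_inj (T T' : finType) (f : T -> T') (X : set G) :
  injective f -> Schur_colorable T X -> Schur_colorable T' X.
Proof.
move=> f_inj [c cP]; exists (f \o c) => a b Xa Xb Xab /f_inj cab /f_inj.
exact: cP.
Qed.

(** The tag [inl] or [inr] of a color records membership in [X], so a monochromatic triple would lie
    wholly in [X] or wholly in [Y]. *)
Lemma Schur_colorableU (T T' : finType) (X Y : set G) :
  Schur_colorable T X -> Schur_colorable T' Y ->
  Schur_colorable (T + T')%type (X `|` Y).
Proof.
move=> [c cP] [d dP].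
exists (fun x => if x \in X then inl (c x) else inr (d x)) => a b.
have [aX|aX] := boolP (a \in X); have [bX|bX] := boolP (b \in X) => //;
  have [abX|abX] := boolP (a + b \in X) => //.
  by move=> _ _ _ [cab] [cb]; apply: (cP a b) => //; exact: set_mem.
move: aX bX abX; rewrite !notin_setE => aX bX abX.
by move=> [//|Ya] [//|Yb] [//|Yab] [dab] [db]; exact: (dP a b).
Qed.

Lemma Schur_colorable1 (x : G) : x != 0 -> Schur_colorable unit [set x].
Proof.
move=> x0; exists (fun=> tt) => _ _ -> -> /= /eqP.
by rewrite -subr_eq0 addrK (negPf x0).
Qed.

Lemma ultrafilter_fiber (S : Type) (F : set_system S) (T : finType)
  (f : S -> T) : UltraFilter F -> exists i, F (f @^-1` [set i]).
Proof.
move=> FU; apply: contrapT => /forallNP noi.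
have /filter_forall/filter_ex[x /(_ (f x))] :
    forall i, F (~` (f @^-1` [set i])) by
  move=> i; have [/noi|] := in_ultra_setVsetC (f @^-1` [set i]) FU.
exact.
Qed.

(* The colorings of the X n converge along a free ultrafilter on nat. *)
Lemma Schur_colorable_bigcup (T : finType) (X : nat -> set G) :
  {homo X : m n / (m <= n)%N >-> m `<=` n} ->
  (forall n, Schur_colorable T (X n)) -> Schur_colorable T (\bigcup_n X n).
Proof.
move=> Xmono /choice[c cP].
have [p [pU oop]] := @ultraFilterLemma nat \oo _.
have /choice[d dP] : forall x, exists i, p [set n | c n x = i].
  by move=> x; exact: (ultrafilter_fiber (c ^~ x)).
exists d => a b [i _ Xa] [j _ Xb] [k _ Xab] dab db.
have /oop pge : \oo [set n | (maxn i (maxn j k) <= n)%N].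
  exact: nbhs_infty_ge.
have /filter_ex[n /= [+ [ca [cb cab]]]] :
    p ([set n | (maxn i (maxn j k) <= n)%N] `&` ([set n | c n a = d a] `&`
       ([set n | c n b = d b] `&` [set n | c n (a + b) = d (a + b)]))).
  by do 3?apply: filterI.
rewrite !geq_max => /and3P[/Xmono iX /Xmono jX /Xmono kX].
apply: (cP n a b); [exact: iX|exact: jX|exact: kX| |].
  by rewrite ca cb.
by rewrite cb cab.
Qed.

(** Some color class belongs to [u], and its intersection with [X] contains a triple, which is then
    monochromatic. *)
Lemma Schur_not_colorable (u : beta G) (T : finType) (X : set G) :
  Defs.Schur u -> beta_sets u X -> ~ Schur_colorable T X.
Proof.
move=> uS uX [c cP].
have [i ui] := ultrafilter_fiber c (beta_ultra u).
have [a [b [[Xa ca] [Xb cb] [Xab cab]]]] := uS _ (@filterI _ u _ _ _ uX ui).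
by apply: (cP a b) => //; rewrite ?ca ?cb ?cab.
Qed.

Lemma exists_free_Schur (X : set G) :
  ~ X 0 -> (forall T : finType, ~ Schur_colorable T X) ->
  exists v : beta G, [/\ free_ultrafilter v, Defs.Schur v & beta_sets v X].
Proof.
move=> X0 Xnc.
pose F : set_system G :=
  [set U | exists T : finType, Schur_colorable T (X `\` U)].
have FP : ProperFilter F.
  apply: Build_ProperFilter.
    by move=> [T]; rewrite setD0; exact: Xnc.
  split.
  - by exists unit; exists (fun=> tt) => a b [_ /(_ I)].
  - move=> P Q [T PT] [T' QT']; exists (T + T')%type.
    rewrite setDIr; exact: Schur_colorableU PT QT'.
  - move=> P Q PQ [T PT]; exists T; apply: Schur_colorable_sub PT.
    exact: setDS.
have [v [vU Fv]] := ultraFilterLemma FP.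
have vX : v X.
  by apply: Fv; exists unit; exists (fun=> tt) => a b [Xa /(_ Xa)].
have v1 x : v (~` [set x]).
  (* As 0 + 0 = 0, the singleton of 0 is not colorable; this case rests on [X] missing 0 instead. *)
  have [->|x0] := eqVneq x 0.
    by apply: filterS vX => y Xy /= y0; apply: X0; rewrite -y0.
  apply: Fv; exists unit; apply: (Schur_colorable_sub (Y := [set x])).
    by move=> y [_ /contrapT].
  exact: Schur_colorable1.
exists (Beta vU); split=> //.
- by rewrite /free_ultrafilter -subset0 => x /(_ _ (v1 x)); apply.
(* If [U] contained no triple, one color would suffice for its part in [X], which puts the
   complement of [U] in [F]. *)
- move=> U vUU; apply: contrapT => noS.
  suff : v (~` U) by move=> /(filterI vUU); rewrite setICr; exact: filter_not_empty.
  apply: Fv; exists unit; exists (fun=> tt) => a b.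
  move=> [_ /contrapT Ua] [_ /contrapT Ub] [_ /contrapT Uab] _ _.
  by apply: noS; exists a, b.
Qed.

End SchurColorings.

Section Integers.
Local Open Scope ring_scope.

(** Color by residues: a triple inside the residue class [i] that belongs to [u] gives i + i = i
    modulo [N.+1], so [i] is 0. *)
Lemma Schur_multiples (u : beta int) (N : nat) :
  Defs.Schur u -> beta_sets u [set x | (N.+1 %| x)%Z].
Proof.
move=> uS; pose f (x : int) : 'I_N.+1 := inord `|(x %% N.+1)%Z|.
have fE x : (f x)%:Z = (x %% N.+1)%Z.
  rewrite inordK ?gez0_abs ?modz_ge0 //.
  by rewrite -ltz_nat gez0_abs ?modz_ge0 // ltz_pmod.
have [i ui] := ultrafilter_fiber f (beta_ultra u).
have [a [b [fa fb fab]]] := uS _ ui.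
suff i0 : i = ord0.
  by apply: filterS ui => x /= fx; apply/dvdz_mod0P; rewrite -fE fx i0.
have : ((f a)%:Z + (f b)%:Z = (f (a + b))%:Z %[mod N.+1])%Z.
  by rewrite !fE modz_mod modzDm.
rewrite fa fb fab => /eqP; rewrite eqz_mod_dvd addrK dvdzE /= => Ni.
apply: val_inj => /=; case: (posnP i) => // i_gt0.
by have := dvdn_leq i_gt0 Ni; rewrite leqNgt ltn_ord.
Qed.

(* The k-th block consists of multiples of a number exceeding twice every
   element of the previous blocks, so that for b in a later block than a the
   sum a + b lies in no block. *)
Lemma sparse_subset (A : set int) :
  (forall (T : finType) (N : nat),
     ~ Schur_colorable T (A `&` [set x | x != 0 /\ (N.+1 %| x)%Z])) ->
  exists S : set int, [/\ S `<=` A, ~ S 0,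
    forall T : finType, ~ Schur_colorable T S &
    forall a, S a -> finite_set [set b | S b /\ S (a + b)]].
Proof.
move=> Anc.
pose F N m := A `&` [set x : int | x != 0 /\ (N.+1 %| x)%Z] `&`
  [set x : int | (`|x| <= m)%N].
have Fmono N m n : (m <= n)%N -> F N m `<=` F N n.
  by move=> mn x [Ax /= xm]; split=> //=; exact: leq_trans xm mn.
have /choice[g gP] : forall rN : nat * nat,
    exists m, ~ Schur_colorable 'I_rN.1 (F rN.2 m).
  move=> [r N] /=; apply: contrapT => /forallNP Fc; apply: (Anc 'I_r N).
  apply: (@Schur_colorable_sub _ _ _ (\bigcup_m F N m)).
    by move=> x Ax; exists `|x|%N => //; split=> /=.
  apply: Schur_colorable_bigcup => [m n|m]; first exact: Fmono.
  exact: contrapT.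
(* [M r] bounds the absolute values in all blocks before the [r]-th. The maximum keeps [M]
   monotone. *)
pose M := fix M r := if r is r'.+1 then
  maxn (M r') (g (r', (M r').*2)) else 0%N.
pose B r := F (M r).*2 (M r.+1).
have Mmono : {homo M : m n / (m <= n)%N}.
  by apply: homo_leq => // [? ? ? /leq_trans|r]; [exact|exact: leq_maxl].
exists (\bigcup_r B r); split.
- by move=> x [r _ [[]]].
- by move=> [r _ [[_ [/eqP]]]].
(* The block whose index is the number of colors already defeats every coloring by [T]. *)
- move=> T TS; apply: (gP (#|T|, (M #|T|).*2)).
  apply: (Schur_colorable_inj enum_rank_inj).
  apply: Schur_colorable_sub TS => x Fx; exists #|T| => //.
  by apply: Fmono Fx; exact: leq_maxr.
move=> a [i _ [[_ [a0 _]] aM]].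
apply: (@sub_finite_set _ _ [set b : int | (`|b| <= M i.+1)%N]); last first.
  apply: (@sub_finite_set _ _
    [set n%:Z - (M i.+1)%:Z | n in `I_(M i.+1).*2.+1]).
    by move=> b bM; exists (absz (b + (M i.+1)%:Z)%R); move: (M _) bM => m /=; lia.
  exact/finite_image/finite_II.
move=> b [[r _ [[_ [b0 Mb]] bM]] [s _ [[_ [ab0 Mab]] abM]]].
apply: (leq_trans bM); apply: (Mmono r.+1 i.+1).
rewrite ltnS leqNgt; apply/negP => ir.
have leM x r' : x != 0 -> ((M r').*2.+1 %| x)%Z -> ((M r').*2 < `|x|)%N.
  by move=> x0; apply: dvdn_leq; rewrite absz_gt0.
have {}aM : (`|a| <= M r)%N by apply: (leq_trans aM); exact: Mmono i.+1 r ir.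
(* Here |a| is at most [M r]. If r < s, then |a + b| is at most 2 [M s]; if s < r, then |b| is at
   most 2 [M r]; if r = s, the divisor of the block divides the nonzero [a]. Each contradicts
   [leM]. *)
have [rs|sr|rs] := ltngtP r s.
- have := leM _ _ ab0 Mab; have := Mmono r.+1 s rs; move: aM bM => /=; lia.
- have := leM _ _ b0 Mb; have := Mmono s.+1 r sr; move: aM abM => /=; lia.
- have : ((M r).*2.+1 %| a)%Z.
    by move: Mab; rewrite -rs rpredDr.
  by move=> /(leM _ _ a0); lia.
Qed.

End Integers.

Lemma beta_base_open (X : Type) (A : set X) : open (beta_base A).
Proof. by exists [set A] => //; rewrite bigcup_set1. Qed.

Lemma open_beta_base (X : Type) (O : set (beta X)) (u : beta X) :
  open O -> O u -> exists2 A, beta_sets u A & beta_base A `<=` O.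
Proof. by move=> [D _ <-] [A DA uA]; exists A => // v vA; exists A. Qed.

Theorem theorem1p2 :
  [/\ Sch_fin int `<=` Sch int,
      open (set_val @^-1` Sch_fin int : set (set_type (Sch int)))
    & dense (set_val @^-1` Sch_fin int : set (set_type (Sch int)))].
Proof.
split; first by move=> u [].
- exists (\bigcup_(A in [set A | forall u : beta int, beta_sets u A ->
      ~ infinitary_Schur u]) beta_base A).
    by apply: bigcup_open => A _; exact: beta_base_open.
  apply/seteqP; split=> [u [A Anot uA]|u [uf uS un]].
    by have [uf uS] := set_valP u; split=> //; exact: Anot.
  move/existsNP : un => [U /not_implyP[uU noU]].
  by exists U => // v vU /(_ _ vU).
move=> O [u Ou] [O' oO' OE]; rewrite -{}OE in Ou *.
have [A uA AO] := open_beta_base oO' Ou.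
have [uf uS] := set_valP u.
have [T N|S [SA S0 Snc Sfin]] := @sparse_subset A.
  apply: (Schur_not_colorable uS).
  apply: filterI => //; apply: filterI; last exact: Schur_multiples.
  have [U uU U0] : exists2 U, beta_sets (set_val u) U & ~ U 0%R.
    apply: contrapT => noU; suff: set0 (0%R : int) by [].
    by rewrite -uf => U uU; apply: contrapT => U0; apply: noU; exists U.
  by apply: filterS uU => x Ux; apply/eqP => x0; apply: U0; rewrite -x0.
have [v [vf vS vS']] := exists_free_Schur S0 Snc.
have vA : beta_sets v A by exact: filterS SA vS'.
exists (exist _ v (mem_set (conj vf vS))); split; first exact: (AO v vA).
(* The set [S] itself refutes the infinitary property of [v]: [Sfin] makes every such [B] finite. *)
split=> // /(_ S vS')[a [B [Sa Binf BS aBS]]]; apply: Binf.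
apply: sub_finite_set (Sfin a Sa) => b Bb; split; first exact: BS.
by apply: aBS; exists b.
Qed.
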